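(* Let $G$ be a word hyperbolic group and $A$ a finitely generated abelian group on which $G$ acts with finite image in $\mathrm{Aut}(A)$. Then every class in $H^2(G;A)$ can be represented by a bounded $2$-cocycle, i.e. a cocycle $\sigma$ with $\sigma(G,G)$ finite.
   Context: The action is written $a\mapsto a^g$. A $2$-cocycle is a function $\sigma:G\times G\to A$ with $\sigma(g,h_1h_2)=\sigma(g,h_1)^{h_2}+\sigma(gh_1,h_2)-\sigma(h_1,h_2)$; coboundaries are $(g,h)\mapsto f(g)^h+f(h)-f(gh)$ for $f:G\to A$; $H^2(G;A)$ is cocycles modulo coboundaries. *)

(* Defs.v *)
From Stdlib Require List.
From mathcomp Require Import all_boot all_order all_algebra.
Set Implicit Arguments. Unset Strict Implicit. Unset Printing Implicit Defensive.
Import GRing.Theory Num.Theory.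
Local Open Scope ring_scope.

Record is_group (G : Type) (mul : G -> G -> G) (one : G) (inv : G -> G) : Prop := {
  grp_assoc : forall x y z, mul x (mul y z) = mul (mul x y) z;
  grp_mul1g : forall x, mul one x = x;
  grp_mulg1 : forall x, mul x one = x;
  grp_mulVg : forall x, mul (inv x) x = one;
  grp_mulgV : forall x, mul x (inv x) = one }.

Definition is_word (G : Type) (inv : G -> G) (S : list G) (w : list G) : Prop :=
  forall x, List.In x w -> List.In x S \/ List.In (inv x) S.

Definition word_prod (G : Type) (mul : G -> G -> G) (one : G) (w : list G) : G :=
  foldr mul one w.

Definition generates (G : Type) (mul : G -> G -> G) (one : G) (inv : G -> G)
  (S : list G) : Prop :=
  forall g, exists w, is_word inv S w /\ word_prod mul one w = g.

Definition word_len (G : Type) (mul : G -> G -> G) (one : G) (inv : G -> G)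
  (S : list G) (g : G) (n : nat) : Prop :=
  (exists w, is_word inv S w /\ word_prod mul one w = g /\ size w = n) /\
  (forall w, is_word inv S w -> word_prod mul one w = g -> (n <= size w)%N).

Definition word_dist (G : Type) (mul : G -> G -> G) (one : G) (inv : G -> G)
  (S : list G) (x y : G) (n : nat) : Prop :=
  word_len mul one inv S (mul (inv x) y) n.

(* Gromov's four-point condition for the word metric, multiplied by 2 to stay
   in the integers:  (x|z)_w >= min((x|y)_w, (y|z)_w) - delta  where
   (x|y)_w = (d(x,w) + d(y,w) - d(x,y)) / 2. *)
Definition word_hyperbolic (G : Type) (mul : G -> G -> G) (one : G) (inv : G -> G) : Prop :=
  exists S : list G, generates mul one inv S /\
  exists delta : nat, forall x y z w : G,
  forall dxw dyw dzw dxy dyz dxz : nat,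
    word_dist mul one inv S x w dxw -> word_dist mul one inv S y w dyw ->
    word_dist mul one inv S z w dzw -> word_dist mul one inv S x y dxy ->
    word_dist mul one inv S y z dyz -> word_dist mul one inv S x z dxz ->
    Num.min (dxw%:Z + dyw%:Z - dxy%:Z) (dyw%:Z + dzw%:Z - dyz%:Z) - (2 * delta)%:Z
      <= dxw%:Z + dzw%:Z - dxz%:Z.

Definition fin_gen_abelian (A : zmodType) : Prop :=
  exists gens : seq A, forall a : A, exists c : seq int,
    size c = size gens /\ a = \sum_(i < size gens) gens`_i *~ c`_i.

Definition is_right_action (G : Type) (mul : G -> G -> G) (one : G) (A : zmodType)
  (act : A -> G -> A) : Prop :=
  [/\ forall g a b, act (a + b) g = act a g + act b g,
      forall a, act a one = a &
      forall a g h, act (act a g) h = act a (mul g h)].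

Definition finite_image (G : Type) (A : zmodType) (act : A -> G -> A) : Prop :=
  exists gs : list G, forall g, exists2 g', List.In g' gs & forall a, act a g = act a g'.

Definition is_2cocycle (G : Type) (mul : G -> G -> G) (A : zmodType)
  (act : A -> G -> A) (sigma : G -> G -> A) : Prop :=
  forall g h1 h2, sigma g (mul h1 h2) =
    act (sigma g h1) h2 + sigma (mul g h1) h2 - sigma h1 h2.

Definition is_2coboundary (G : Type) (mul : G -> G -> G) (A : zmodType)
  (act : A -> G -> A) (tau : G -> G -> A) : Prop :=
  exists f : G -> A, forall g h, tau g h = act (f g) h + f h - f (mul g h).

Definition cohomologous (G : Type) (mul : G -> G -> G) (A : zmodType)
  (act : A -> G -> A) (s1 s2 : G -> G -> A) : Prop :=
  is_2coboundary mul act (fun g h => s1 g h - s2 g h).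

Definition bounded_cochain (G : Type) (A : zmodType) (sigma : G -> G -> A) : Prop :=
  exists L : list A, forall g h, List.In (sigma g h) L.

(* Main.v *)
(* Let [E] be the extension of [G] by [A] with class [sigma], and lift the
   generators of [G] to [E].  For a functional [lam : A -> Z] and a large
   constant [K], let [f lam g] be the maximum over the words [w] representing
   [g] of [lam (a)] minus [K] times the length of [w], where [a] is the
   [A]-coordinate of the lift of [w].  Replacing a short non-geodesic subword by
   a geodesic increases this quantity, so that only local geodesics matter; in
   a hyperbolic space these are uniformly tight, which makes the maximum finite.
   The defect [T] of additivity of [f] is a nonnegative cocycle, cohomologous to
   [- lam sigma], and it vanishes along the optimal paths.  If [u] is a center of
   the triangle [x y z], this forces [T x y z], [T u y u] and [T z y x] to agree
   up to a constant, while for every cocycle [T x y z + T z y x] is a coboundary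
   up to a constant.  Hence [2 T], and so [2 lam sigma], is a bounded
   perturbation of a coboundary.

   This is done uniformly for the finite [G]-orbits of coordinate functionals of
   [A].  Summing over the finite image of [G] turns the resulting cochains into
   an [A]-valued one, at the price of replacing [sigma] by a multiple
   [M sigma]; dividing by [M] in [A] has finite remainders and finite fibres. *)
From HB Require Import structures.
From Stdlib Require Import Classical IndefiniteDescription FunctionalExtensionality.
Require Import Defs.
From mathcomp Require Import all_boot all_order all_algebra.
From mathcomp Require Import zify.
Set Implicit Arguments. Unset Strict Implicit. Unset Printing Implicit Defensive.
Import Order.TTheory GRing.Theory Num.Theory.

(** * Local geodesics and cocycles on four-point hyperbolic spaces *)

Section FourPoint.
Variables (X : Type) (d : X -> X -> nat) (delta : nat).
Hypothesis dxx : forall x, d x x = 0.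
Hypothesis dC : forall x y, d x y = d y x.
Hypothesis d_triangle : forall x y z, d x z <= d x y + d y z.
Hypothesis d_four_point : forall x y z w,
  d x z + d y w <= d x y + d z w + 2 * delta \/
  d x z + d y w <= d y z + d x w + 2 * delta.

Section LocalGeodesic.
Variables (p : nat -> X) (n : nat).
Hypothesis p_local : forall i j, i <= j <= n -> j - i <= 2 * (4 * delta + 1) ->
  d (p i) (p j) = j - i.

(** Put [L = 4 * delta + 1]. In the four-point condition on [p (j - L)], [p i], [p (j + t)], [p j],
    one case is the claim; the other contradicts the induction hypothesis at [j - L], since
    [2 * L > 4 * delta]. *)
Lemma local_geodesic_extend i j t : i <= j -> t <= 4 * delta + 1 -> j + t <= n ->
  d (p i) (p j) + t <= d (p i) (p (j + t)) + 2 * delta.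
Proof.
have [k] := ubnP (j - i); elim: k => // k IH in i j t *.
move=> lt_k le_ij le_t le_n.
have [le_L|lt_L] := leqP (j - i) (4 * delta + 1).
  by rewrite !p_local; lia.
pose j' := j - (4 * delta + 1).
have j'L : j' + (4 * delta + 1) = j by lia.
have := IH i j' (4 * delta + 1); rewrite j'L.
have := @p_local j' (j + t); have := @p_local j (j + t); have := @p_local j' j.
have := d_four_point (p j') (p i) (p (j + t)) (p j).
have := dC (p j') (p i); have := dC (p (j + t)) (p j); lia.
Qed.

(** The same dichotomy after advancing from [j] to [m = j + L]. The bad case would give
    [2 * L <= 8 * delta], which is why [L] exceeds [4 * delta]. *)
Lemma local_geodesic_tight i j l : i <= j -> j <= l -> l <= n ->
  d (p i) (p j) + d (p j) (p l) <= d (p i) (p l) + 4 * delta.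
Proof.
have [k] := ubnP (l - j); elim: k => // k IH in i j l *.
move=> lt_k le_ij le_jl le_n.
have [le_L|lt_L] := leqP (l - j) (4 * delta + 1).
  have := @local_geodesic_extend i j (l - j).
  by rewrite subnKC // (p_local (i := j)); lia.
have H1 := @local_geodesic_extend i j (4 * delta + 1).
set m := j + (4 * delta + 1) in H1.
have H2 := IH j m l.
have := @p_local j m; have := d_four_point (p i) (p l) (p m) (p j).
have := dC (p l) (p j); have := dC (p m) (p j); have := dC (p l) (p m); lia.
Qed.

(** Each advance by [4 * delta + 1] steps gains at least [2 * delta + 1] in distance from [p 0]. *)
Lemma local_geodesic_length j : j <= n -> j <= (4 * delta + 1) * (d (p 0) (p j)).+1.
Proof.
have [k] := ubnP j; elim: k => // k IH in j *.
move=> lt_k le_n; have [le_L|lt_L] := leqP j (4 * delta + 1); first by nia.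
have := IH (j - (4 * delta + 1)).
have := @local_geodesic_extend 0 (j - (4 * delta + 1)) (4 * delta + 1).
rewrite subnK; last by lia.
nia.
Qed.

End LocalGeodesic.

Hypothesis d_geodesic : forall x y m, m <= d x y ->
  exists2 u, d x u = m & d u y = d x y - m.

Lemma quasi_center x y z : exists u,
  [/\ d x u + d u y <= d x y + 2 * delta + 2,
      d y u + d u z <= d y z + 2 * delta + 2 &
      d x u + d u z <= d x z + 2 * delta + 2].
Proof.
have := d_triangle x y z; have := d_triangle y x z; have := d_triangle x z y.
have := dC z y; have := dC y x; move=> yx zy t1 t2 t3.
(* The center lies on a geodesic from [x] to [y], at the Gromov product of [y] and [z] based at [x];
   the summand 2 covers the rounding. *)
have [|u xu uy] := @d_geodesic x y ((d x y + d x z - d y z) %/ 2); first by lia.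
exists u; have := d_four_point u y z x; have := dC u x; have := dC z x; have := dC y u; split; lia.
Qed.

Lemma discrete_ivt (p : nat -> X) (n m : nat) :
  (forall i, i < n -> d (p i) (p i.+1) <= 1) -> m <= d (p 0) (p n) ->
  exists2 i, i <= n & d (p 0) (p i) = m.
Proof.
elim: n m => [|n IH] m step le_m.
  by exists 0 => //; move: le_m; rewrite dxx; lia.
have [le_m'|lt_m] := leqP m (d (p 0) (p n)).
  by have [|//|i le_i <-] := IH m; [move=> i lt_i; apply: step; lia | exists i => //; lia].
exists n.+1 => //; have := step n (ltnSn n); have := d_triangle (p 0) (p n) (p n.+1); lia.
Qed.

(** * Nonnegative cocycles vanishing along near-geodesic paths *)

Section Cocycle.
Variables (T : X -> X -> X -> int) (b : int).
Local Open Scope ring_scope.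
Hypothesis T_ge0 : forall x y z, 0 <= T x y z.
Hypothesis T_cocycle : forall x y z t, T y z t - T x z t + T x y t - T x y z = 0.
Hypothesis T_near : forall u v, (d u v <= 8 * delta + 2)%N -> T u v u <= b.
Hypothesis T_path : forall x y, exists (n : nat) (p : nat -> X),
  [/\ p 0 = x, p n = y, forall i, (i < n)%N -> (d (p i) (p i.+1) <= 1)%N,
      forall i, (i <= n)%N -> (d x (p i) + d (p i) y <= d x y + 4 * delta)%N &
      forall i, (i <= n)%N -> T x (p i) y = 0].

Lemma T_tight x u y : (d x u + d u y <= d x y + 2 * delta + 2)%N -> T x u y <= 2 * b.
Proof.
move=> tight; have [n [p [p0 pn step tube Tp]]] := T_path x y.
(* The minimum is needed because [u] may lie farther from [x] than [y] does. *)
have [|i le_i xi] := @discrete_ivt p n (minn (d x u) (d x y)) step.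
  by rewrite p0 pn geq_minr.
rewrite p0 in xi; have tube_i := tube i le_i; have Ti := Tp i le_i.
have uv : (d u (p i) <= 8 * delta + 2)%N.
  have := d_four_point u y (p i) x.
  have := dC y x; have := dC (p i) x; have := dC u x; have := dC y (p i); lia.
(* With [v = p i], where [T x v y = 0], the cocycle identities give
   [T x u y <= T x u v <= T u v u + T u u u], and both last terms are at most [b]. *)
have := T_near uv; have := @T_near u u; rewrite dxx => /(_ isT).
have := T_cocycle x u (p i) y; have := T_cocycle x u (p i) u.
have := T_cocycle x u u u; have := T_ge0 u (p i) y; have := T_ge0 x (p i) u; lia.
Qed.

(* Up to a constant, both terms are [T u y u] for any quasi-center [u]. *)
Lemma T_reverse x y z : `|T x y z - T z y x| <= 8 * b.
Proof.
have [u [xy yz xz]] := quasi_center x y z.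
have := @T_near u u; rewrite dxx => /(_ isT) uu.
have := T_tight xy; have := T_tight yz; have := T_tight xz.
have := @T_tight y u x; rewrite (dC y u) (dC u x) (dC y x) addnC => /(_ xy).
have := @T_tight z u y; rewrite (dC z u) (dC u y) (dC z y) addnC => /(_ yz).
have := @T_tight z u x; rewrite (dC z u) (dC u x) (dC z x) addnC => /(_ xz).
have := T_cocycle x u y z; have := T_cocycle u y u z; have := T_cocycle u u u z.
have := T_cocycle z u y x; have := T_cocycle u y u x; have := T_cocycle u u u x.
have := T_ge0 x u y; have := T_ge0 y u z; have := T_ge0 x u z.
have := T_ge0 y u x; have := T_ge0 z u y; have := T_ge0 z u x; have := T_ge0 u u u.
lia.
Qed.

(* For a cocycle, [T x y z + T z y x = T x y x + T y z y - T x z x + T y y y]. *)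
Lemma double_cocycle_bounded x y z :
  `|2 * T x y z - T x y x - T y z y + T x z x| <= 9 * b.
Proof.
have := T_reverse x y z; have := @T_near y y; rewrite dxx => /(_ isT).
have := T_cocycle x y z y; have := T_cocycle x z y x; have := T_cocycle x y y y.
have := T_ge0 y y y; lia.
Qed.

End Cocycle.
End FourPoint.

(** * Word metrics *)

Lemma list_bounded (T : Type) (F : T -> int) (L : list T) :
  exists B : int, forall x, List.In x L -> (`|F x| <= B)%R.
Proof.
elim: L => [|y L [B HB]]; first by exists 0%R.
by exists (`|F y| + `|B|)%R => x [<-|/HB]; lia.
Qed.

Section WordMetric.
Variables (G : Type) (mul : G -> G -> G) (one : G) (inv : G -> G).
Hypothesis G_group : is_group mul one inv.
Local Notation "x ** y" := (mul x y) (at level 40, left associativity).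

Let mulA x y z : x ** y ** z = x ** (y ** z).
Proof. by rewrite (grp_assoc G_group). Qed.
Let mulKg x y : inv x ** (x ** y) = y.
Proof. by rewrite -mulA (grp_mulVg G_group) (grp_mul1g G_group). Qed.
Let mulVKg x y : x ** (inv x ** y) = y.
Proof. by rewrite -mulA (grp_mulgV G_group) (grp_mul1g G_group). Qed.

Lemma grp_invK x : inv (inv x) = x.
Proof. by rewrite -[LHS](grp_mulg1 G_group) -(grp_mulVg G_group x) mulKg. Qed.

Lemma grp_invM x y : inv (x ** y) = inv y ** inv x.
Proof.
rewrite -[RHS](mulKg (x ** y)) (mulA x) mulVKg (grp_mulgV G_group).
by rewrite (grp_mulg1 G_group).
Qed.

Lemma grp_inv1 : inv one = one.
Proof. by rewrite -[LHS](grp_mulg1 G_group) (grp_mulVg G_group). Qed.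

Definition grp_simp := (grp_invM, grp_inv1, grp_invK, mulA, mulKg, mulVKg,
  grp_mulVg G_group, grp_mulgV G_group, grp_mul1g G_group, grp_mulg1 G_group).

Local Notation wprod := (word_prod mul one).

Lemma word_prod_cat u v : wprod (u ++ v) = wprod u ** wprod v.
Proof. by elim: u => /= [|x u ->]; rewrite grp_simp. Qed.

Lemma word_prod_rev_inv w : wprod (rev (map inv w)) = inv (wprod w).
Proof.
elim: w => /= [|x w IH]; first by rewrite grp_inv1.
by rewrite rev_cons -cats1 word_prod_cat IH /= !grp_simp.
Qed.

Variable S : list G.
Local Notation isw := (is_word inv S).

Lemma is_word_cat u v : isw (u ++ v) <-> isw u /\ isw v.
Proof.
split=> [H|[Hu Hv] x /List.in_app_iff[/Hu|/Hv] //].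
by split=> x Hx; apply: H; apply/List.in_app_iff; [left|right].
Qed.

Lemma is_word_cons x w : isw (x :: w) <-> isw [:: x] /\ isw w.
Proof. exact: (is_word_cat [:: x] w). Qed.

Lemma is_word_rev_inv w : isw w -> isw (rev (map inv w)).
Proof.
elim: w => [//|x w IH] /is_word_cons[Hx /IH Hw].
rewrite /= rev_cons -cats1; apply/is_word_cat; split=> // y [<-|//].
by rewrite grp_invK; case: (Hx x (or_introl erefl)); [right|left].
Qed.

Lemma finitely_many_words n :
  exists L, forall w, isw w -> size w <= n -> List.In w L.
Proof.
elim: n => [|n [L HL]]; first by exists [:: [::]] => -[|x w] // _ _; left.
exists ([::] :: List.flat_map (fun x => List.map (cons x) L) (S ++ List.map inv S)).
move=> [|x w]; first by left.
move=> /is_word_cons[Hx Hw] sz; right; apply/List.in_flat_map; exists x; split.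
  apply/List.in_app_iff; case: (Hx x (or_introl erefl)) => H; [by left|right].
  by rewrite -(grp_invK x); apply: List.in_map.
by apply/List.in_map/HL.
Qed.

Hypothesis S_gen : generates mul one inv S.

Lemma word_len_exists g : exists n, word_len mul one inv S g n.
Proof.
suff H n w : isw w -> wprod w = g -> size w < n ->
    exists n, word_len mul one inv S g n.
  by have [w [Hw Pw]] := S_gen g; apply: (H (size w).+1 w).
elim: n w => // n IH w Hw Pw sz.
case: (classic (exists w', isw w' /\ wprod w' = g /\ size w' < size w)).
  by move=> [w' [Hw' [Pw' lt]]]; apply: (IH w') => //; lia.
move=> Hmin; exists (size w); split; first by exists w.
by move=> w' Hw' Pw'; rewrite leqNgt; apply/negP => lt; apply: Hmin; exists w'.
Qed.

Lemma word_len_fun : exists len, forall g, word_len mul one inv S g (len g).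
Proof. exact: functional_choice word_len_exists. Qed.

Variable len : G -> nat.
Hypothesis len_spec : forall g, word_len mul one inv S g (len g).

Definition wdist x y := len (inv x ** y).

Lemma len_le w : isw w -> len (wprod w) <= size w.
Proof. by move=> Hw; apply: (proj2 (len_spec _)). Qed.

Lemma wdistxx x : wdist x x = 0.
Proof.
apply/eqP; rewrite -leqn0 /wdist (grp_mulVg G_group).
exact: (@len_le [::]).
Qed.

Lemma lenV_le g : len (inv g) <= len g.
Proof.
have [[w [Hw [<- <-]]] _] := len_spec g.
rewrite -word_prod_rev_inv -(size_map inv w) -size_rev.
exact/len_le/is_word_rev_inv.
Qed.

Lemma wdistC x y : wdist x y = wdist y x.
Proof.
suff le u v : wdist u v <= wdist v u by apply/eqP; rewrite eqn_leq !le.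
by rewrite /wdist -[inv u ** v]grp_invK grp_invM grp_invK; apply: lenV_le.
Qed.

Lemma wdist_triangle x y z : wdist x z <= wdist x y + wdist y z.
Proof.
rewrite /wdist; have -> : inv x ** z = (inv x ** y) ** (inv y ** z).
  by rewrite !grp_simp.
have [[u [Hu [<- <-]]] _] := len_spec (inv x ** y).
have [[v [Hv [<- <-]]] _] := len_spec (inv y ** z).
by rewrite -word_prod_cat -size_cat; apply/len_le/is_word_cat.
Qed.

Lemma wdist_translate g x y : wdist (g ** x) (g ** y) = wdist x y.
Proof. by rewrite /wdist !grp_simp. Qed.

Lemma wdist_geodesic x y m : m <= wdist x y ->
  exists2 u, wdist x u = m & wdist u y = wdist x y - m.
Proof.
have [[w [Hw [Pw szw]]] _] := len_spec (inv x ** y) => le_m.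
rewrite -/(wdist x y) in szw.
have [Ht Hd] : isw (take m w) /\ isw (drop m w).
  by apply/is_word_cat; rewrite cat_take_drop.
have xu : wdist x (x ** wprod (take m w)) <= m.
  rewrite /wdist !grp_simp; apply: leq_trans (len_le Ht) _.
  by rewrite size_take_min geq_minl.
have uy : wdist (x ** wprod (take m w)) y <= size w - m.
  have -> : y = x ** wprod w by rewrite Pw !grp_simp.
  rewrite wdist_translate -{2}(cat_take_drop m w) word_prod_cat /wdist !grp_simp.
  by apply: leq_trans (len_le Hd) _; rewrite size_drop.
have := wdist_triangle x (x ** wprod (take m w)) y.
by exists (x ** wprod (take m w)); lia.
Qed.

Lemma ball_finite n : exists L, forall g, len g <= n -> List.In g L.
Proof.
have [L HL] := finitely_many_words n; exists (List.map wprod L) => g.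
have [[w [Hw [<- <-]]] _] := len_spec g => sz.
exact/List.in_map/HL.
Qed.

Definition local_geodesic k w := forall a b c, w = a ++ b ++ c -> size b <= k ->
  size b <= len (wprod b).

Lemma local_geodesic_path k w x : isw w -> local_geodesic k w ->
  forall i j, i <= j <= size w -> j - i <= k ->
  wdist (x ** wprod (take i w)) (x ** wprod (take j w)) = j - i.
Proof.
move=> Hw lg i j /andP[le_ij le_j] le_k.
rewrite wdist_translate /wdist.
have tj : take j w = take i w ++ drop i (take j w).
  by rewrite -{1}(cat_take_drop i (take j w)) take_takel.
have E : w = take i w ++ drop i (take j w) ++ drop j w.
  by rewrite catA -tj cat_take_drop.
have sz : size (drop i (take j w)) = j - i.
  by rewrite size_drop size_takel.
rewrite tj word_prod_cat mulKg; apply/eqP; rewrite eqn_leq -{1}sz len_le /=.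
  by rewrite -{1}sz (lg _ _ _ E) // sz.
by have := Hw; rewrite {1}E => /is_word_cat[_ /is_word_cat[]].
Qed.

End WordMetric.

(** * Optimal words *)

(** Clearing the Gromov products leaves a comparison of sums of opposite sides; the two cases are
    the two arguments of the minimum. *)
Lemma four_point_sum (G : Type) (mul : G -> G -> G) (one : G) (inv : G -> G)
  (S : list G) (len : G -> nat) (delta : nat) :
  (forall g, word_len mul one inv S g (len g)) ->
  (forall x y z w : G, forall dxw dyw dzw dxy dyz dxz : nat,
    word_dist mul one inv S x w dxw -> word_dist mul one inv S y w dyw ->
    word_dist mul one inv S z w dzw -> word_dist mul one inv S x y dxy ->
    word_dist mul one inv S y z dyz -> word_dist mul one inv S x z dxz ->
    (Num.min (dxw%:Z + dyw%:Z - dxy%:Z) (dyw%:Z + dzw%:Z - dyz%:Z) - (2 * delta)%:Z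
      <= dxw%:Z + dzw%:Z - dxz%:Z)%R) ->
  forall x y z w, let d := wdist mul inv len in
  d x z + d y w <= d x y + d z w + 2 * delta \/
  d x z + d y w <= d y z + d x w + 2 * delta.
Proof.
move=> lenP H x y z w d.
have := H x y z w _ _ _ _ _ _ (lenP _) (lenP _) (lenP _) (lenP _) (lenP _) (lenP _).
rewrite -/(wdist mul inv len x w) -/(wdist mul inv len y w) -/(wdist mul inv len z w).
rewrite -/(wdist mul inv len x y) -/(wdist mul inv len y z) -/(wdist mul inv len x z).
rewrite -/d; lia.
Qed.

Section TwistedFunctional.
Variables (G : Type) (mul : G -> G -> G) (one : G) (inv : G -> G).
Variables (A : zmodType) (act : A -> G -> A).
Hypothesis G_group : is_group mul one inv.
Hypothesis act_right : is_right_action mul one act.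
Local Notation "x ** y" := (mul x y) (at level 40, left associativity).
Local Open Scope ring_scope.

(** The left action of [G] on functionals dual to the right action on [A]. *)
Definition twist (g : G) (lam : A -> int) : A -> int := fun a => lam (act a g).

Lemma twist1 lam : twist one lam = lam.
Proof.
by case: act_right => _ act1 _; apply: functional_extensionality => a; rewrite /twist act1.
Qed.

Lemma twistM g h lam : twist g (twist h lam) = twist (g ** h) lam.
Proof.
by case: act_right => _ _ actM; apply: functional_extensionality => a; rewrite /twist actM.
Qed.

Variable sigma : G -> G -> A.
Hypothesis sigma_cocycle : is_2cocycle mul act sigma.
Local Notation wprod := (word_prod mul one).

(* The [A]-coordinate of the product of the lifts [(x, 0)], [x] in [w], in the
   extension [G x A] with law [(g, a)(h, b) = (gh, a^h + b + sigma g h)]; the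
   unit of this extension is [(1, - sigma 1 1)]. *)
Fixpoint word_lift (w : seq G) : A :=
  if w is x :: w' then word_lift w' + sigma x (wprod w') else - sigma one one.

(** Concatenation is multiplication in the extension, so the cocycle identity carries the induction;
    the empty word needs [sigma one g = act (sigma one one) g]. *)
Lemma word_lift_cat u v :
  word_lift (u ++ v) =
    act (word_lift u) (wprod v) + word_lift v + sigma (wprod u) (wprod v).
Proof.
case: act_right => actD act1 actM.
have act0 g : act 0 g = 0.
  by apply: (addIr (act 0 g)); rewrite -actD !add0r.
elim: u => [|x u IH] /=.
  have := sigma_cocycle one one (wprod v); rewrite !(grp_mul1g G_group) => ->.
  have -> : act (- sigma one one) (wprod v) = - act (sigma one one) (wprod v).
    by apply: (addIr (act (sigma one one) (wprod v))); rewrite -actD !addNr act0.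
  by rewrite addrK addrAC addNr add0r.
rewrite IH (word_prod_cat G_group) sigma_cocycle actD.
by rewrite [_ + _ - _]addrC !addrA addrK [X in X + _ = _]addrAC.
Qed.

Variables (S : list G) (len : G -> nat) (delta : nat).
Hypothesis S_gen : generates mul one inv S.
Hypothesis len_spec : forall g, word_len mul one inv S g (len g).
Hypothesis d_four_point : forall x y z w, let d := wdist mul inv len in
  (d x z + d y w <= d x y + d z w + 2 * delta \/
  d x z + d y w <= d y z + d x w + 2 * delta)%N.

Variable Lam : (A -> int) -> Prop.
Hypothesis Lam_add : forall lam, Lam lam -> forall a b, lam (a + b) = lam a + lam b.
Hypothesis Lam_twist : forall g lam, Lam lam -> Lam (twist g lam).
Arguments Lam_twist g {lam} _.
Hypothesis Lam_finite : exists L, forall lam, Lam lam -> List.In lam L.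

Lemma functional_sub lam a b : Lam lam -> lam (a - b) = lam a - lam b.
Proof. by move=> Hl; rewrite -[in RHS](subrK b a) (Lam_add Hl) addrK. Qed.

Local Notation isw := (is_word inv S).
Local Notation rad := (2 * (4 * delta + 1))%N.

Lemma short_lift_bounded : exists C : int, forall lam w, Lam lam -> isw w ->
  (size w <= rad)%N -> `|lam (word_lift w)| <= C.
Proof.
have [Ll HLl] := Lam_finite; have [Lw HLw] := finitely_many_words G_group S rad.
have [C HC] := list_bounded (fun p : (A -> int) * seq G => p.1 (word_lift p.2))
  (List.list_prod Ll Lw).
exists C => lam w Hl Hw sz.
by apply: (HC (lam, w)); apply: List.in_prod; [apply: HLl|apply: HLw].
Qed.

Section OptimalWords.
Variable C : int.
Hypothesis C_bound : forall lam w, Lam lam -> isw w -> (size w <= rad)%N ->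
  `|lam (word_lift w)| <= C.

(* The slope [2 * C + 1] makes it profitable to shorten a word by a single
   letter, which costs at most [2 * C]. *)
Definition word_value lam w : int := lam (word_lift w) - (2 * C + 1) * (size w)%:Z.

Lemma word_value_cat lam u v : Lam lam ->
  word_value lam (u ++ v) =
    word_value (twist (wprod v) lam) u + word_value lam v
    + lam (sigma (wprod u) (wprod v)).
Proof.
move=> Hl; rewrite /word_value word_lift_cat !(Lam_add Hl) size_cat PoszD mulrDr.
rewrite /twist; lia.
Qed.

(** The outer factors contribute equally. Under the functional twisted by [wprod c], the lifts of
    [b] and [b'] differ by at most [2 * C], while the length term gains at least [2 * C + 1]. *)
Lemma word_value_shorten lam a b b' c : Lam lam -> isw b -> isw b' ->
  (size b <= rad)%N -> (size b' < size b)%N -> wprod b' = wprod b ->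
  word_value lam (a ++ b ++ c) < word_value lam (a ++ b' ++ c).
Proof.
move=> Hl Hb Hb' sz lt E.
rewrite !word_value_cat ?(word_prod_cat G_group) ?E //.
have Ht := Lam_twist (wprod c) Hl; rewrite /word_value.
have C1 := C_bound Ht Hb sz.
have C2 : `|twist (wprod c) lam (word_lift b')| <= C by apply: C_bound => //; lia.
nia.
Qed.

(** Replacing short non-geodesic subwords by geodesic ones shortens the word each time, so the
    process stops. *)
Lemma local_geodesic_improvement lam w : Lam lam -> isw w -> exists w',
  [/\ isw w', wprod w' = wprod w, local_geodesic mul one len rad w' &
      word_value lam w <= word_value lam w'].
Proof.
move=> Hl; have [n] := ubnP (size w); elim: n w => // n IH w lt_n Hw.
have [lg|] := classic (local_geodesic mul one len rad w).
  by exists w.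
move=> nlg; have [a [b [c [Ew sz lt]]]] : exists a b c,
    [/\ w = a ++ b ++ c, (size b <= rad)%N & (len (wprod b) < size b)%N].
  apply: NNPP => H; apply: nlg => a b c Ew sz; rewrite leqNgt; apply/negP => lt.
  by apply: H; exists a, b, c.
have [[b' [Hb' [Pb' szb']]] _] := len_spec (wprod b).
move: Hw; rewrite {1}Ew => /is_word_cat[Ha /is_word_cat[Hb Hc]].
have lt' : (size b' < size b)%N by rewrite szb'.
have := @word_value_shorten lam a b b' c Hl Hb Hb' sz lt' Pb'; rewrite -Ew => lt_v.
have [||w' [Hw' Pw' lg le_v]] := IH (a ++ b' ++ c).
- by move: lt_n; rewrite Ew !size_cat; lia.
- by apply/is_word_cat; split=> //; apply/is_word_cat.
exists w'; split=> //; last by lia.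
by rewrite Pw' Ew !(word_prod_cat G_group) Pb'.
Qed.

Lemma local_geodesic_size w : isw w -> local_geodesic mul one len rad w ->
  (size w <= (4 * delta + 1) * (len (wprod w)).+1)%N.
Proof.
move=> Hw lg; have := @local_geodesic_length _ (wdist mul inv len) delta.
move=> /(_ (wdistC G_group len_spec) d_four_point (fun i => one ** wprod (take i w))).
move=> /(_ (size w) (local_geodesic_path G_group len_spec one Hw lg) (size w) (leqnn _)).
by rewrite take0 take_size /wdist !(grp_simp G_group).
Qed.

(** Every word is dominated by a local geodesic with the same product, and the linear length bound
    leaves only finitely many of these for a given [g]. *)
Lemma optimal_word_exists lam g : Lam lam -> exists w,
  [/\ isw w, wprod w = g, local_geodesic mul one len rad w &
      forall w', isw w' -> wprod w' = g -> word_value lam w' <= word_value lam w].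
Proof.
move=> Hl; pose P w := [/\ isw w, wprod w = g & local_geodesic mul one len rad w].
have [w0 Pw0] : exists w, P w.
  have [w [Hw Pw]] := S_gen g.
  have [w' [? E ? _]] := local_geodesic_improvement Hl Hw.
  by exists w'; split=> //; rewrite E.
have [L HL] := finitely_many_words G_group S ((4 * delta + 1) * (len g).+1).
have [w Pw max_w] : exists2 w, P w &
    forall w', P w' -> List.In w' L -> word_value lam w' <= word_value lam w.
  elim: (L) => [|x L' [w Pw max_w]]; first by exists w0.
  have [[Px lt]|nPx] := classic (P x /\ word_value lam w < word_value lam x).
    exists x => // w' Pw' [<-//|/(max_w _ Pw')]; lia.
  exists w => // w' Pw' [E|/(max_w _ Pw')//]; rewrite -E leNgt; apply/negP => lt.
  by apply: nPx; rewrite -E in Pw'.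
have [Hw Ew lg] := Pw; exists w; split=> // w' Hw' Ew'.
have [w1 [Hw1 Ew1 lg1 le1]] := local_geodesic_improvement Hl Hw'.
have Pw1 : P w1 by split=> //; rewrite Ew1.
apply: le_trans le1 (max_w _ Pw1 _); apply: HL => //.
by rewrite -Ew' -Ew1; apply: local_geodesic_size.
Qed.

Lemma max_value_exists : exists f : (A -> int) -> G -> int, forall lam, Lam lam ->
  (forall w, isw w -> word_value lam w <= f lam (wprod w)) /\
  (forall g, exists w, [/\ isw w, wprod w = g, local_geodesic mul one len rad w &
     word_value lam w = f lam g]).
Proof.
have H (q : (A -> int) * G) : exists v, Lam q.1 ->
    (forall w, isw w -> wprod w = q.2 -> word_value q.1 w <= v) /\
    (exists w, [/\ isw w, wprod w = q.2, local_geodesic mul one len rad w &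
       word_value q.1 w = v]).
  (* Outside [Lam] the value 0 is a dummy. *)
  have [Hl|nl] := classic (Lam q.1); last by exists 0.
  have [w [Hw Pw lg max_w]] := @optimal_word_exists q.1 q.2 Hl.
  by exists (word_value q.1 w) => _; split=> //; exists w.
have [f Hf] := functional_choice _ H; exists (fun lam g => f (lam, g)) => lam Hl.
split=> [w Hw|g]; first exact: (proj1 (Hf (lam, wprod w) Hl)).
exact: (proj2 (Hf (lam, g) Hl)).
Qed.

End OptimalWords.

(** * The defect of additivity as a cocycle *)

Section Defect.
Variable f : (A -> int) -> G -> int.

(* Inhomogeneous 2-cocycle in [g], [h] with values in functions of [lam];
   [hom_defect] is its homogeneous form, with a fixed functional at the base
   point. *)
Definition defect lam g h : int :=
  f lam (g ** h) - f (twist h lam) g - f lam h - lam (sigma g h).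

(** The [f] terms form a coboundary and cancel; what remains is the cocycle identity of [sigma]. *)
Lemma defect_cocycle lam g h k : Lam lam ->
  defect (twist k lam) g h + defect lam (g ** h) k =
  defect lam h k + defect lam g (h ** k).
Proof.
move=> Hl; rewrite /defect !twistM !(grp_simp G_group).
have := congr1 lam (sigma_cocycle g h k).
rewrite functional_sub // (Lam_add Hl) /twist; lia.
Qed.

Definition hom_defect mu x y z : int :=
  defect (twist (inv z) mu) (inv x ** y) (inv y ** z).

Lemma hom_defect_cocycle mu x y z t : Lam mu ->
  hom_defect mu y z t - hom_defect mu x z t + hom_defect mu x y t
  - hom_defect mu x y z = 0.
Proof.
move=> Hm.
have := @defect_cocycle (twist (inv t) mu) (inv x ** y) (inv y ** z) (inv z ** t) (Lam_twist _ Hm).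
rewrite /hom_defect !twistM !(grp_simp G_group); lia.
Qed.

End Defect.

(** For the maximal value [f], the defect is the coboundary of [- f] minus [lam sigma], while twice
    the defect is the coboundary of [P] up to a constant; hence [m = - 2 f - P]. *)
Lemma doubled_functionals_bounded :
  exists (m : (A -> int) -> G -> int) (B : int), forall lam, Lam lam -> forall g h,
    `|m (twist h lam) g + m lam h - m lam (g ** h) - 2 * lam (sigma g h)| <= B.
Proof.
have [C HC] := short_lift_bounded.
have [f Hf] := max_value_exists HC.
(* Optimal words for [g] and [h], concatenated, compete for [g ** h]. *)
have defect_ge0 lam g h : Lam lam -> 0 <= defect f lam g h.
  move=> Hl; have [_ /(_ g)[u [Hu Pu _ Vu]]] := Hf _ (Lam_twist h Hl).
  have [max_l /(_ h)[v [Hv Pv _ Vv]]] := Hf _ Hl.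
  have Huv : isw (u ++ v) by apply/is_word_cat.
  have := max_l _ Huv; rewrite word_value_cat // (word_prod_cat G_group) Pu Pv Vu Vv.
  rewrite /defect; lia.
(* Neither part exceeds its own maximum, so an optimal concatenation forces the defect to be at most
   0. *)
have defect_split lam u v : Lam lam -> isw (u ++ v) ->
    word_value C lam (u ++ v) = f lam (wprod (u ++ v)) ->
    defect f lam (wprod u) (wprod v) = 0.
  move=> Hl /is_word_cat[Hu Hv]; have := defect_ge0 lam (wprod u) (wprod v) Hl.
  have := proj1 (Hf _ (Lam_twist (wprod v) Hl)) _ Hu.
  have := proj1 (Hf _ Hl) _ Hv.
  rewrite word_value_cat // (word_prod_cat G_group) /defect; lia.
have [Ll HLl] := Lam_finite.
(* If [u] and [v] are this close, [T u v u] depends only on [inv u ** v] in a finite ball and on one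
   of finitely many functionals. *)
have [Lb HLb] := ball_finite G_group len_spec (8 * delta + 2).
have [b Hb] := list_bounded
  (fun p : (A -> int) * G => defect f p.1 p.2 (inv p.2)) (List.list_prod Ll Lb).
pose P lam g := defect f (twist g lam) g (inv g).
exists (fun lam g => - 2 * f lam g - P lam g), (9 * b) => lam Hl g h.
(* This choice makes [lam] the functional attached to the endpoint [g ** h]. *)
pose mu := twist (g ** h) lam; have Hmu : Lam mu by apply: Lam_twist.
have := @double_cocycle_bounded G (wdist mul inv len) delta (wdistxx G_group len_spec)
  (wdistC G_group len_spec) (wdist_triangle G_group len_spec) d_four_point
  (wdist_geodesic G_group len_spec) (hom_defect f mu) b.
move=> /(_ _ _ _ _ one g (g ** h)) H.
have {H} : `|2 * hom_defect f mu one g (g ** h) - hom_defect f mu one g one -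
       hom_defect f mu g (g ** h) g + hom_defect f mu one (g ** h) one| <= 9 * b.
  apply: H.
  - by move=> x y z; apply: defect_ge0; apply: Lam_twist.
  - by move=> x y z t; apply: hom_defect_cocycle.
  - move=> u v uv; have Ht := Lam_twist (inv u) Hmu.
    have := Hb (twist (inv u) mu, inv u ** v).
    rewrite /hom_defect /= !(grp_simp G_group) => Hb'.
    apply: le_trans (ler_norm _) (Hb' _).
    by apply: List.in_prod; [apply: HLl | apply: HLb].
  move=> x y; have Ht := Lam_twist (inv y) Hmu.
  have [_ /(_ (inv x ** y))[w [Hw Pw lg Vw]]] := Hf _ Ht.
  (* The prefixes of an optimal word trace a local geodesic, hence a tight path, and each of them
     splits the word with zero defect. *)
  exists (size w), (fun i => x ** wprod (take i w)).
  have pn : x ** wprod (take (size w) w) = y.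
    by rewrite take_size Pw !(grp_simp G_group).
  have p0 : x ** wprod (take 0 w) = x by rewrite take0 /= (grp_simp G_group).
  have path := local_geodesic_path G_group len_spec x Hw lg.
  split=> // [i lt_i|i le_i|i le_i].
  - by rewrite path; lia.
  - have := local_geodesic_tight (wdistC G_group len_spec) d_four_point path
      (leq0n i) le_i (leqnn _).
    by rewrite p0 pn.
  - rewrite /hom_defect; have -> : inv x ** (x ** wprod (take i w)) = wprod (take i w).
      by rewrite (grp_simp G_group).
    have -> : inv (x ** wprod (take i w)) ** y = wprod (drop i w).
      rewrite -{}pn take_size -{2}(cat_take_drop i w) (word_prod_cat G_group).
      by rewrite !(grp_simp G_group).
    apply: defect_split => //; first by rewrite cat_take_drop.
    by rewrite cat_take_drop Pw.
rewrite /hom_defect /mu !twistM !(grp_simp G_group).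
rewrite /P !twistM !(grp_simp G_group) /defect !twistM !(grp_simp G_group) !twist1.
lia.
Qed.

End TwistedFunctional.

(** * Finitely generated abelian groups *)

Local Open Scope ring_scope.

Lemma ex_minimal_nat (P : nat -> Prop) n : P n ->
  exists2 m, P m & forall k, P k -> (m <= k)%N.
Proof.
have [N] := ubnP n; elim: N n => // N IH n lt_n Pn.
have [[k [Pk lt_k]]|nex] := classic (exists k, P k /\ (k < n)%N).
  by apply: (IH k) => //; lia.
by exists n => // k Pk; rewrite leqNgt; apply/negP => lt_k; apply: nex; exists k.
Qed.

Lemma additive_of_fun (U V : zmodType) (f : U -> V) :
  (forall a b, f (a + b) = f a + f b) -> exists F : {additive U -> V}, forall a, F a = f a.
Proof.
move=> fD; have f0 : f 0 = 0 by apply: (addIr (f 0)); rewrite -fD !add0r.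
by exists (HB.pack_for {additive U -> V} f (GRing.isNmodMorphism.Build U V f (conj f0 fD))).
Qed.

Lemma mem_In (T : eqType) (x : T) s : x \in s -> List.In x s.
Proof. by elim: s => //= y s IH; rewrite inE => /predU1P[->|/IH]; [left|right]. Qed.

(** * Families with finitely many values *)

Definition finite_valued (I T : Type) (x : I -> T) := exists L, forall i, List.In (x i) L.

Lemma finite_valued_comp (I T U : Type) (f : T -> U) (x : I -> T) :
  finite_valued x -> finite_valued (fun i => f (x i)).
Proof. by case=> L HL; exists (List.map f L) => i; apply/List.in_map. Qed.

Lemma finite_valued_comp2 (I T U V : Type) (f : T -> U -> V) (x : I -> T) (y : I -> U) :
  finite_valued x -> finite_valued y -> finite_valued (fun i => f (x i) (y i)).
Proof.
move=> [L HL] [L' HL'].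
have := @finite_valued_comp I _ _ (fun p => f p.1 p.2) (fun i => (x i, y i)).
by apply; exists (List.list_prod L L') => i; apply: List.in_prod.
Qed.

Lemma finite_valued_sum (I : Type) (A : zmodType) n (x : 'I_n -> I -> A) :
  (forall k, finite_valued (x k)) -> finite_valued (fun i => \sum_(k < n) x k i).
Proof.
elim: n x => [|n IH] x Hx; first by exists [:: 0] => i; rewrite big_ord0; left.
have [L HL] := finite_valued_comp2 +%R (Hx ord0) (IH _ (fun k => Hx (lift ord0 k))).
by exists L => i; rewrite big_ord_recl.
Qed.

Lemma finite_valued_int (I : Type) (x : I -> int) (B : int) :
  (forall i, `|x i| <= B) -> finite_valued x.
Proof.
move=> HB; exists (map (fun k : nat => k%:Z - B) (iota 0 `|(2 * B + 1)%R|%N)) => i.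
have := HB i => Hi; apply/mem_In/mapP; exists `|(x i + B)%R|%N; last by lia.
by rewrite mem_iota; lia.
Qed.

Lemma finite_valued_bounded (I T : Type) (x : I -> T) (F : T -> int) :
  finite_valued x -> exists B : int, forall i, `|F (x i)| <= B.
Proof.
by move=> [L HL]; have [B HB] := list_bounded F L; exists B => i; apply: HB.
Qed.

Lemma common_bound n (I : Type) (x : 'I_n -> I -> int) :
  (forall k, exists B : int, forall i, `|x k i| <= B) ->
  exists B : int, forall k i, `|x k i| <= B.
Proof.
move=> /functional_choice[b Hb]; exists (\sum_k `|b k|) => k i.
apply: le_trans (Hb k i) _; rewrite (bigD1 k) //=.
by apply: le_trans (ler_norm _) _; rewrite lerDl; apply: sumr_ge0.
Qed.

Section FinGen.
Variable A : zmodType.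
Hypothesis A_fin_gen : fin_gen_abelian A.

Lemma fin_gen_span : exists n (v : 'I_n -> A), forall a, exists c : 'I_n -> int,
  a = \sum_i v i *~ c i.
Proof.
have [gens Hg] := A_fin_gen; exists (size gens), (fun i => gens`_i) => a.
by have [c [_ ->]] := Hg a; exists (fun i => c`_i).
Qed.

(** Take the least [r] for which [r] elements span some nonzero multiple of [A]. Minimality makes
    them independent, so coordinates are unique and therefore additive. *)
Lemma rational_coordinates : exists r (e : 'I_r -> A) (c : 'I_r -> A -> int) (N : int),
  [/\ N != 0, forall i a b, c i (a + b) = c i a + c i b &
      forall a, a *~ N = \sum_i e i *~ c i a].
Proof.
pose spans r := exists (e : 'I_r -> A) (N : int), N != 0 /\
  forall a, exists c : 'I_r -> int, a *~ N = \sum_i e i *~ c i.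
have [n [v Hv]] := fin_gen_span.
have : spans n by exists v, 1; split=> // a; rewrite mulr1z.
move=> /ex_minimal_nat[r [e [N [N0 He]]] min_r].
have free (c : 'I_r -> int) : \sum_i e i *~ c i = 0 -> forall i, c i = 0.
  move=> Hc j; apply/eqP; apply: contraT => cj.
  have r0 : (0 < r)%N by apply: leq_ltn_trans (ltn_ord j).
  case: r r0 => // r _ in e He min_r c Hc j cj *.
  suff /min_r : spans r by rewrite ltnn.
  (* Multiplying by [c j] lets the relation eliminate [e j]. *)
  exists (fun i => e (lift j i)), (N * c j); split; first by rewrite mulf_neq0.
  move=> a; have [d Hd] := He a.
  exists (fun i => d (lift j i) * c j - c (lift j i) * d j).
  rewrite mulrzA Hd; move: Hc; rewrite !(bigD1_ord j) //= => /eqP; rewrite addr_eq0 => /eqP Hc.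
  rewrite mulrzDl mulrzAC Hc mulNrz addrC !mulrz_suml -sumrB.
  by apply: eq_bigr => i _; rewrite mulrzBr !mulrzA.
have [c Hc] := functional_choice _ He.
exists r, e, (fun i a => c a i), N; split=> // i a b.
apply/eqP; rewrite -subr_eq0; apply/eqP.
apply: (free (fun i => c (a + b) i - (c a i + c b i))).
under eq_bigr do rewrite mulrzBr mulrzDr.
by rewrite sumrB big_split /= -!Hc mulrzDl subrr.
Qed.

Lemma finite_index_multiples (M : int) : M != 0 ->
  exists q rem : A -> A, (forall a, a = q a *~ M + rem a) /\ finite_valued rem.
Proof.
move=> M0; have [n [v Hv]] := fin_gen_span; have [c Hc] := functional_choice _ Hv.
exists (fun a => \sum_i v i *~ (c a i %/ M)%Z), (fun a => \sum_i v i *~ (c a i %% M)%Z).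
split=> [a|].
  rewrite mulrz_suml -big_split {1}(Hc a); apply: eq_bigr => i _ /=.
  by rewrite -mulrzA -mulrzDr -divz_eq.
apply: finite_valued_sum => k; apply: finite_valued_comp.
apply: (@finite_valued_int _ _ `|M|) => a.
by rewrite ger0_norm ?modz_ge0 // ltW // ltz_mod.
Qed.

(** Coordinates miss torsion, so write [x = q *~ N + rem]: the first term is determined by the
    coordinates of [q], which are bounded because [N] times them is, and [rem] has finitely many
    values. *)
Lemma bounded_coordinates_finite (I : Type) (x : I -> A) r (e : 'I_r -> A)
    (c : 'I_r -> A -> int) (N B : int) :
  N != 0 -> (forall i a b, c i (a + b) = c i a + c i b) ->
  (forall a, a *~ N = \sum_i e i *~ c i a) ->
  (forall k i, `|c k (x i)| <= B) -> finite_valued x.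
Proof.
move=> N0 cD He Hx; have [q [rem [qr rem_fin]]] := finite_index_multiples N0.
have -> : x = fun i => (\sum_k e k *~ c k (q (x i))) + rem (x i).
  by apply: functional_extensionality => i; rewrite -He -qr.
have rem_x : finite_valued (fun i => rem (x i)).
  by case: rem_fin => L HL; exists L.
have [B' HB'] := common_bound (fun k => finite_valued_bounded (c k) rem_x).
apply: finite_valued_comp2 => //; apply: finite_valued_sum => k.
apply: finite_valued_comp; apply: (@finite_valued_int _ _ (B + B')) => i.
have := Hx k i; have := HB' k i; rewrite {2}(qr (x i)) cD.
have [F HF] := additive_of_fun (cD k).
by rewrite -(HF (_ *~ N)) raddfMz HF -mulrzr intz; nia.
Qed.

End FinGen.

(** * From functionals back to the module *)

Section Transfer.
Variables (G : Type) (mul : G -> G -> G) (one : G) (inv : G -> G).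
Variables (A : zmodType) (act : A -> G -> A).
Hypothesis G_group : is_group mul one inv.
Hypothesis act_right : is_right_action mul one act.
Hypothesis act_finite : finite_image act.
Local Notation "x ** y" := (mul x y) (at level 40, left associativity).

Lemma act_sum n (v : 'I_n -> A) g : act (\sum_i v i) g = \sum_i act (v i) g.
Proof.
case: act_right => actD _ _; have [F HF] := additive_of_fun (actD g).
by rewrite -HF raddf_sum; apply: eq_bigr => i _.
Qed.

Lemma actMz a z g : act (a *~ z) g = act a g *~ z.
Proof.
by case: act_right => actD _ _; have [F HF] := additive_of_fun (actD g); rewrite -!HF raddfMz.
Qed.

Lemma actB a b g : act (a - b) g = act a g - act b g.
Proof.
by case: act_right => actD _ _; have [F HF] := additive_of_fun (actD g); rewrite -!HF raddfB.
Qed.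

Lemma same_action_inv x y : (forall a, act a x = act a y) ->
  forall a, act a (inv x) = act a (inv y).
Proof.
case: act_right => _ act1 actM H a.
have E : act (act a (inv y)) x = a by rewrite H actM (grp_mulVg G_group) act1.
by rewrite -{1}E actM (grp_mulgV G_group) act1.
Qed.

(** A minimal covering family represents each automorphism in the image exactly once, so right
    translation by [h] permutes it. *)
Lemma action_transversal : exists n (rho : 'I_n -> G), (0 < n)%N /\
  (forall h, exists2 tau : 'I_n -> 'I_n, injective tau &
     forall i a, act a (rho i ** h) = act a (rho (tau i))).
Proof.
case: act_right => _ act1 actM.
pose covers n := exists rho : 'I_n -> G, forall g, exists i, forall a, act a g = act a (rho i).
have : exists n, covers n.
  have [gs Hgs] := act_finite; exists (size gs), (fun i => nth one gs i) => g.
  have [g' Hin E] := Hgs g.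
  have [i lt_i Ei] : exists2 i, (i < size gs)%N & nth one gs i = g'.
    elim: (gs) Hin => //= x s IH [->|/IH[i lt_i <-]]; first by exists 0%N.
    by exists i.+1.
  by exists (Ordinal lt_i) => a; rewrite E /= Ei.
move=> [n0 /ex_minimal_nat[n [rho Hrho] min_n]].
have rho_inj i j : (forall a, act a (rho i) = act a (rho j)) -> i = j.
  move=> E; apply/eqP; apply: contraT => ij.
  case: n rho Hrho min_n i j E ij => [|n] rho Hrho min_n i j E ij; first by case: i E ij.
  suff /min_n : covers n by rewrite ltnn.
  exists (fun k => rho (lift i k)) => g; have [k Hk] := Hrho g.
  have [Eik|ik] := eqVneq i k.
    have [k' Ek'] := unlift_some ij; exists k' => a.
    by rewrite -Ek' -E Eik.
  by have [k' Ek'] := unlift_some ik; exists k' => a; rewrite -Ek'.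
exists n, rho; split=> [|h]; first by have [i _] := Hrho one; apply: leq_ltn_trans (ltn_ord i).
have [tau Htau] := functional_choice _ (fun i => Hrho (rho i ** h)).
exists tau => // i j Eij; apply: rho_inj => a.
have E : act a (rho i ** h) = act a (rho j ** h) by rewrite !Htau Eij.
have K x : act (act a (x ** h)) (inv h) = act a x by rewrite actM !(grp_simp G_group).
by rewrite -(K (rho i)) E K.
Qed.

Variable sigma : G -> G -> A.
Variables (r : nat) (e : 'I_r -> A) (c : 'I_r -> A -> int) (N : int).
Hypothesis c_coordinates : forall a, a *~ N = \sum_k e k *~ c k a.
Variables (m : (A -> int) -> G -> int) (B : int).
Hypothesis m_bounded : forall k x lam, lam = twist act x (c k) -> forall g h,
  `|m (twist act h lam) g + m lam h - m lam (g ** h) - 2 * lam (sigma g h)| <= B.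

(* The map sending [F] to [\sum_i act (\sum_k e k *~ F (lam i k)) (rho i)] is
   equivariant, and its composite with [a |-> (lam |-> lam a)] is multiplication
   by [n * N]. *)
Lemma transfer_bounded : N != 0 -> exists (Phi : G -> A) (M : int), M != 0 /\
  finite_valued (fun p : G * G =>
    act (Phi p.1) p.2 + Phi p.2 - Phi (p.1 ** p.2) - sigma p.1 p.2 *~ M).
Proof.
move=> N0; case: (act_right) => actD act1 actM.
have [n [rho [n_gt0 Hrho]]] := action_transversal.
pose lam i k := twist act (inv (rho i)) (c k).
pose W (F : 'I_n -> 'I_r -> int) := \sum_i act (\sum_k e k *~ F i k) (rho i).
have WD F F' : W F + W F' = W (fun i k => F i k + F' i k).
  rewrite /W -big_split; apply: eq_bigr => i _; rewrite /= -actD -big_split.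
  by congr (act _ _); apply: eq_bigr => k _; rewrite /= mulrzDr.
have WN F : - W F = W (fun i k => - F i k).
  rewrite /W -sumrN; apply: eq_bigr => i _; rewrite -mulrN1z -actMz mulrz_suml.
  by congr (act _ _); apply: eq_bigr => k _; rewrite mulrN1z mulrNz.
pose Phi g := W (fun i k => m (lam i k) g).
(* Equivariance: after reindexing by [tau], twisting [lam (tau i) k] by [h] gives [lam i k]. *)
have act_Phi g h : act (Phi g) h = W (fun i k => m (twist act h (lam i k)) g).
  have [tau tau_inj Htau] := Hrho h.
  rewrite /W (reindex_inj tau_inj) act_sum; apply: eq_bigr => i _.
  rewrite actM Htau; congr (act _ _); apply: eq_bigr => k _; congr (_ *~ m _ _).
  apply: functional_extensionality => a; rewrite /lam /twist.
  have := same_action_inv (Htau i) (act a h) => /esym ->.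
  by rewrite actM !(grp_simp G_group).
(* Each index [i] contributes [2 * N] times [sigma g h]: the action of [rho i] undoes the twist by
   its inverse. *)
have W_sigma g h : sigma g h *~ (n%:Z * (2 * N)) = W (fun i k => 2 * lam i k (sigma g h)).
  rewrite /W (eq_bigr (fun=> sigma g h *~ (2 * N))) => [|i _].
    by rewrite sumr_const card_ord -mulrzA_C.
  rewrite (eq_bigr (fun k => e k *~ lam i k (sigma g h) *~ 2)) => [|k _]; last first.
    by rewrite mulrzA_C.
  by rewrite -mulrz_suml -c_coordinates -mulrzA actMz actM !(grp_simp G_group) act1 mulrC.
exists Phi, (n%:Z * (2 * N)); split; first by rewrite !mulf_neq0 //; lia.
have -> : (fun p : G * G => act (Phi p.1) p.2 + Phi p.2 - Phi (p.1 ** p.2)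
    - sigma p.1 p.2 *~ (n%:Z * (2 * N))) =
  (fun p => W (fun i k => m (twist act p.2 (lam i k)) p.1 + m (lam i k) p.2
    - m (lam i k) (p.1 ** p.2) - 2 * lam i k (sigma p.1 p.2))).
  apply: functional_extensionality => -[g h] /=.
  by rewrite act_Phi W_sigma !WN !WD.
apply: finite_valued_sum => i.
apply: (finite_valued_comp (fun a => act a (rho i))).
apply: finite_valued_sum => k; apply: finite_valued_comp.
by apply: (@finite_valued_int _ _ B) => -[g h] /=; apply: (m_bounded (k := k) (x := inv (rho i))).
Qed.

End Transfer.

(** * From a multiple of the class to the class itself *)

Section BoundedRepresentative.
Variables (G : Type) (mul : G -> G -> G) (one : G) (inv : G -> G).
Variables (A : zmodType) (act : A -> G -> A).
Hypothesis G_group : is_group mul one inv.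
Hypothesis act_right : is_right_action mul one act.
Hypothesis act_finite : finite_image act.
Local Notation "x ** y" := (mul x y) (at level 40, left associativity).

Definition cobound (f : G -> A) g h := act (f g) h + f h - f (g ** h).

Lemma coboundD f f' g h :
  cobound (fun x => f x + f' x) g h = cobound f g h + cobound f' g h.
Proof.
case: (act_right) => actD _ _.
by rewrite /cobound /= actD [_ + _ + (f h + _)]addrACA opprD [LHS]addrACA.
Qed.

Lemma coboundMz f z g h : cobound (fun x => f x *~ z) g h = cobound f g h *~ z.
Proof. by rewrite /cobound (actMz act_right) mulrzBl mulrzDl. Qed.

Lemma cobound_cocycle f : is_2cocycle mul act (cobound f).
Proof.
case: (act_right) => actD _ actM g h k; rewrite /cobound.
rewrite (actB act_right) actD !actM !(grp_assoc G_group).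
set f1 := act (f g) _; set f2 := act (f h) k; set f3 := f k; set f4 := f (h ** k).
set f5 := f (g ** h ** k).
rewrite opprB [RHS]addrA [X in _ = X + _ - _]addrA [X in _ = X + _ + _ - _]addrA subrK.
rewrite -[f1 + f2 + f3]addrA (addrC f1 (f2 + f3)); move: (f2 + f3) => P.
by rewrite [RHS]addrC -!addrA addKr (addrC (- f5)).
Qed.

Lemma cocycle_sub sigma tau : is_2cocycle mul act sigma -> is_2cocycle mul act tau ->
  is_2cocycle mul act (fun g h => sigma g h - tau g h).
Proof.
move=> Hs Ht g h k; rewrite Hs Ht (actB act_right) [X in _ = X - _]addrACA -opprD.
by rewrite !opprB [LHS]addrACA [RHS]addrACA; congr (_ + _); apply: addrC.
Qed.

Lemma cobound_finite_valued f : finite_valued f ->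
  finite_valued (fun p : G * G => cobound f p.1 p.2).
Proof.
move=> [L HL]; have [gs Hgs] := act_finite.
have fin (F : G * G -> G) : finite_valued (fun p : G * G => f (F p)).
  by exists L => p; apply: HL.
apply: (finite_valued_comp2 (fun a b : A => a - b)); last exact: (fin (fun p => p.1 ** p.2)).
apply: (finite_valued_comp2 +%R); last exact: (fin snd).
exists (List.map (fun q => act q.1 q.2) (List.list_prod L gs)) => -[g h] /=.
have [h' Hin ->] := Hgs h.
by apply: (List.in_map (fun q => act q.1 q.2) _ (f g, h')); apply: List.in_prod.
Qed.

(** Writing [Phi = psi *~ M + rem], the coboundary of [rem] has finitely many values, hence so has
    [M] times [sigma - cobound psi]. Its coordinates are then bounded, and so are those of
    [sigma - cobound psi]. *)
Lemma bounded_of_multiple sigma (M : int) (Phi : G -> A) : fin_gen_abelian A ->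
  is_2cocycle mul act sigma -> M != 0 ->
  finite_valued (fun p : G * G => cobound Phi p.1 p.2 - sigma p.1 p.2 *~ M) ->
  exists sigma' : G -> G -> A,
    [/\ is_2cocycle mul act sigma', bounded_cochain sigma' &
        cohomologous mul act sigma sigma'].
Proof.
move=> A_fg Hs M0 HPhi; have [q [rem [qr [L HL]]]] := finite_index_multiples A_fg M0.
pose psi g := q (Phi g); exists (fun g h => sigma g h - cobound psi g h).
split; first by apply: cocycle_sub => //; apply: cobound_cocycle.
2: by exists psi => g h; rewrite opprB addrC subrK.
have rho_fin : finite_valued (fun g => rem (Phi g)) by exists L => g; apply: HL.
have fin_M : finite_valued
    (fun p : G * G => (sigma p.1 p.2 - cobound psi p.1 p.2) *~ M).
  have := finite_valued_comp2 (fun a b : A => a - b) (cobound_finite_valued rho_fin) HPhi.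
  case=> L' HL'; exists L' => -[g h] /=; move: (HL' (g, h)) => /=.
  have -> : cobound Phi g h = cobound psi g h *~ M + cobound (fun x => rem (Phi x)) g h.
    rewrite -coboundMz -coboundD; congr (cobound _ g h).
    by apply: functional_extensionality => x; rewrite -qr.
  have sub_shift (a b d : A) : a - (b + a - d) = d - b.
    by rewrite opprB addrC opprD addrA subrK.
  by rewrite mulrzBl sub_shift.
have [r [e [c [N [N0 cD Hc]]]]] := rational_coordinates A_fg.
have [B HB] := common_bound (fun k => finite_valued_bounded (c k) fin_M).
have [|L' HL'] := @bounded_coordinates_finite _ A_fg _
  (fun p : G * G => sigma p.1 p.2 - cobound psi p.1 p.2) _ e c N B N0 cD Hc.
  move=> k p; apply: le_trans (HB k p).
  have [F HF] := additive_of_fun (cD k).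
  by rewrite -!HF raddfMz -mulrzr intz; nia.
by exists L' => g h; apply: (HL' (g, h)).
Qed.

End BoundedRepresentative.

Theorem theorem3p1 (G : Type) (mul : G -> G -> G) (one : G) (inv : G -> G)
  (A : zmodType) (act : A -> G -> A) :
  is_group mul one inv ->
  word_hyperbolic mul one inv ->
  fin_gen_abelian A ->
  is_right_action mul one act ->
  finite_image act ->
  forall sigma : G -> G -> A, is_2cocycle mul act sigma ->
  exists sigma' : G -> G -> A,
    [/\ is_2cocycle mul act sigma', bounded_cochain sigma' &
        cohomologous mul act sigma sigma'].
Proof.
move=> G_group [S [S_gen [delta hyp]]] A_fg act_right act_fin sigma Hs.
have [len len_spec] := word_len_fun S_gen.
have fp := four_point_sum len_spec hyp.
have [r [e [c [N [N0 cD Hc]]]]] := rational_coordinates A_fg.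
(* The [G]-orbits of the coordinate functionals, finite because the action has finite image. *)
pose Lam lam := exists k g, lam = twist act g (c k).
have Lam_add lam : Lam lam -> forall a b, lam (a + b) = lam a + lam b.
  by case: (act_right) => actD _ _ [k [g ->]] a b; rewrite /twist actD cD.
have Lam_twist g lam : Lam lam -> Lam (twist act g lam).
  by move=> [k [h ->]]; exists k, (mul g h); rewrite (twistM act_right).
have Lam_fin : exists L, forall lam, Lam lam -> List.In lam L.
  have [gs Hgs] := act_fin.
  exists (List.map (fun p => twist act p.2 (c p.1)) (List.list_prod (enum 'I_r) gs)).
  move=> lam [k [g ->]]; have [g' Hin E] := Hgs g.
  have -> : twist act g (c k) = twist act g' (c k).
    by apply: functional_extensionality => a; rewrite /twist E.
  apply: (List.in_map (fun p => twist act p.2 (c p.1)) _ (k, g')).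
  by apply: List.in_prod => //; apply: mem_In; rewrite mem_enum.
have [m [B Hm]] := doubled_functionals_bounded G_group act_right Hs S_gen len_spec
  fp Lam_add Lam_twist Lam_fin.
have [|Phi [M [M0 HPhi]]] := @transfer_bounded _ _ _ _ _ _ G_group act_right act_fin
    sigma _ e c N Hc m B _ N0.
  by move=> k x lam Elam; apply: Hm; exists k, x.
exact: (bounded_of_multiple G_group act_right act_fin A_fg Hs M0 HPhi).
Qed.
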